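(* Consider the one-dimensional ESFR semi-discretization of the diffusion equation $\partial_t u=b\,\Delta u$ described in the context, with correction functions $g_L,g_R$ (parameter $\kappa$) for the auxiliary equation and $h_L,h_R$ (parameter $c$) for the primary equation. If either the IP or the BR2 numerical fluxes are employed, then the resulting scheme is independent of $\kappa$: after elimination of $q_n$, the expression of $\partial u_n/\partial t$ on each element $\Omega_n$ in terms of the discrete solution $u$ is the same for all admissible $\kappa$.
   Context: Mesh: the interval $\Omega$ is partitioned into elements $\Omega_n=[x_n,x_{n+1}]$, $1\le n\le N_K$, with $h_n=x_{n+1}-x_n$ and $J_n=h_n/2$; $\Omega_n$ is mapped affinely from $r\in[-1,1]$ by $x=\frac{1-r}{2}x_n+\frac{1+r}{2}x_{n+1}$. On each $\Omega_n$, $u_n$ and $q_n$ are polynomials of degree $\le p$ ($p\ge1$). $\nabla=\partial/\partial x$, $\nabla_r=\partial/\partial r$, $b>0$. Correction functions: $\Psi_m$ is the Legendre polynomial of degree $m$ (with $\Psi_m(1)=1$), $a_p=\frac{(2p)!}{2^p(p!)^2}$, $\eta_{p,\kappa}=\frac{\kappa(2p+1)(a_pp!)^2}{2}$, and $\kappa$ is admissible if $1+\eta_{p,\kappa}>0$. The ESFR correction functions with parameter $\kappa$ are $$g_L=\frac{(-1)^p}{2}\left[\Psi_p-\frac{\eta_{p,\kappa}\Psi_{p-1}+\Psi_{p+1}}{1+\eta_{p,\kappa}}\right],\quad g_R=\frac12\left[\Psi_p+\frac{\eta_{p,\kappa}\Psi_{p-1}+\Psi_{p+1}}{1+\eta_{p,\kappa}}\right],$$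 and $h_L,h_R$ are given by the same formulas with an admissible parameter $c$ in place of $\kappa$. Scheme: on every element, $$\frac{\partial u_n}{\partial t}=\frac{b}{J_n}\left[\nabla_r q_n+(q^*-q_n)|_{-1}\nabla_r h_L+(q^*-q_n)|_{1}\nabla_r h_R\right],$$ $$q_n=\frac1{J_n}\left[\nabla_r u_n+(u^*-u_n)|_{-1}\nabla_r g_L+(u^*-u_n)|_{1}\nabla_r g_R\right],$$ where $|_{\mp1}$ denotes evaluation at the left/right endpoint of $\Omega_n$. Fluxes: at an edge $e$, let $v_{e,-}$, $v_{e,+}$ be the traces of $v$ from the left and right element; $[\![v_e]\!]=v_{e,-}-v_{e,+}$, $\{\{v_e\}\}=\frac12(v_{e,-}+v_{e,+})$. IP fluxes: $u^*=\{\{u\}\}$, $q^*=\{\{\nabla u\}\}-\tau[\![u]\!]$ with $\tau$ a penalty parameter. BR2 fluxes: $u^*=\{\{u\}\}$, $q^*=\{\{\nabla u\}\}+s\{\{r^e([\![u]\!])\}\}$ with $s$ a penalty parameter, where the lifting operator $r^e([\![u]\!])$ is the piecewise polynomial of degree $\le p$ on the mesh with $\int_\Omega r^e([\![u]\!])\phi\,dx=-[\![u_e]\!]\{\{\phi_e\}\}$ for all piecewise polynomials $\phi$ of degree $\le p$. Here $\nabla u$ is the elementwise derivative of $u$ in $x$. Boundary conditions are periodic, or Dirichlet with the convention that the jump at the two boundary edges is $0$ (so $u^*=u_n$ there) and $q^*$ at the boundary does not depend on $q$. *)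

(* Defs.v *)
From HB Require Import structures.
From mathcomp Require Import all_boot all_order all_algebra.
From mathcomp Require Import all_classical all_reals all_analysis.

Set Implicit Arguments.
Unset Strict Implicit.
Unset Printing Implicit Defensive.

Import Order.TTheory GRing.Theory Num.Theory.
Import numFieldNormedType.Exports.
Local Open Scope classical_set_scope.
Local Open Scope ring_scope.

(* Rodrigues' formula; this normalisation gives (legendre R m).[1] = 1. *)
Definition legendre (R : realType) (m : nat) : {poly R} :=
  (2 ^+ m * (m`!)%:R)^-1 *: (('X^2 - 1) ^+ m)^`(m).

Definition esfr_a (R : realType) (p : nat) : R :=
  ((2 * p)`!)%:R / (2 ^+ p * (p`!)%:R ^+ 2).

Definition esfr_eta (R : realType) (p : nat) (kappa : R) : R :=
  kappa * (2 * p + 1)%:R * (esfr_a R p * (p`!)%:R) ^+ 2 / 2.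

Definition admissible (R : realType) (p : nat) (kappa : R) : Prop :=
  0 < 1 + esfr_eta p kappa.

Definition corrL (R : realType) (p : nat) (kappa : R) : {poly R} :=
  ((-1) ^+ p / 2) *:
    (legendre R p -
     (1 + esfr_eta p kappa)^-1 *:
       (esfr_eta p kappa *: legendre R p.-1 + legendre R p.+1)).

Definition corrR (R : realType) (p : nat) (kappa : R) : {poly R} :=
  2^-1 *:
    (legendre R p +
     (1 + esfr_eta p kappa)^-1 *:
       (esfr_eta p kappa *: legendre R p.-1 + legendre R p.+1)).

(* Element n is [x n, x (n + 1)]; elements are numbered from 0. *)
Definition node_l (R : realType) (N : nat) (x : 'I_N.+1 -> R) (n : 'I_N) : R :=
  x (widen_ord (leqnSn N) n).

Definition node_r (R : realType) (N : nat) (x : 'I_N.+1 -> R) (n : 'I_N) : R :=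
  x (lift ord0 n).

Definition jac (R : realType) (N : nat) (x : 'I_N.+1 -> R) (n : 'I_N) : R :=
  (node_r x n - node_l x n) / 2.

(* Inverse of r |-> (1 - r) / 2 * x_n + (1 + r) / 2 * x_(n+1). *)
Definition ref_coord (R : realType) (N : nat) (x : 'I_N.+1 -> R) (n : 'I_N)
    (y : R) : R :=
  (2 * y - node_l x n - node_r x n) / (node_r x n - node_l x n).

(* A piecewise polynomial is stored elementwise, as a polynomial in the
   reference coordinate r in [-1, 1]. *)
Definition pwpoly (R : realType) (N : nat) : Type := 'I_N -> {poly R}.

Definition pw_deg_le (R : realType) (N p : nat) (v : pwpoly R N) : Prop :=
  forall n, (size (v n) <= p.+1)%N.

Definition pw_grad (R : realType) (N : nat) (x : 'I_N.+1 -> R)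
    (v : pwpoly R N) : pwpoly R N :=
  fun n => (jac x n)^-1 *: (v n)^`().

(* Edge e : 'I_N is the right end of element e.  Its right neighbour is taken
   cyclically, so the last edge is the periodic wrap-around edge; under
   Dirichlet conditions that edge is never used. *)
Definition trace_m (R : realType) (N : nat) (v : pwpoly R N) (e : 'I_N) : R :=
  (v e).[1].

Definition trace_p (R : realType) (N : nat) (v : pwpoly R N) (e : 'I_N) : R :=
  (v (ordS e)).[-1].

Definition jump (R : realType) (N : nat) (v : pwpoly R N) (e : 'I_N) : R :=
  trace_m v e - trace_p v e.

Definition avg (R : realType) (N : nat) (v : pwpoly R N) (e : 'I_N) : R :=
  (trace_m v e + trace_p v e) / 2.

(* In the Dirichlet case u* is the interior trace of u at the two ends, and q*
   there is an arbitrary function of time and of u, hence not of q. *)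
Inductive bdry_cond (R : realType) (N : nat) : Type :=
  | Periodic
  | Dirichlet (qbL qbR : R -> pwpoly R N -> R).

Definition is_edge (R : realType) (N : nat) (bc : bdry_cond R N) (e : 'I_N)
    : bool :=
  if bc is Dirichlet _ _ then (e.+1 < N)%N else true.

Definition is_lifting (R : realType) (N : nat) (x : 'I_N.+1 -> R) (p : nat)
    (e : 'I_N) (j : R) (r : pwpoly R N) : Prop :=
  pw_deg_le p r /\
  forall phi : pwpoly R N, pw_deg_le p phi ->
    \sum_(n < N)
      \int[lebesgue_measure]_(y in `[node_l x n, node_r x n])
        ((r n).[ref_coord x n y] * (phi n).[ref_coord x n y])
    = - j * avg phi e.

(* The penalty parameter may vary from edge to edge; the last argument of BR2
   is the lifting operator (e, [[u]]) |-> r^e([[u]]), see flux_ok. *)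
Inductive flux (R : realType) (N : nat) : Type :=
  | IP (tau : 'I_N -> R)
  | BR2 (s : 'I_N -> R) (r : 'I_N -> R -> pwpoly R N).

Definition flux_ok (R : realType) (N : nat) (x : 'I_N.+1 -> R) (p : nat)
    (bc : bdry_cond R N) (F : flux R N) : Prop :=
  match F with
  | IP _ => True
  | BR2 _ r => forall e j, is_edge bc e -> is_lifting x p e j (r e j)
  end.

Definition ustar (R : realType) (N : nat) (u : pwpoly R N) (e : 'I_N) : R :=
  avg u e.

Definition qstar (R : realType) (N : nat) (x : 'I_N.+1 -> R) (F : flux R N)
    (u : pwpoly R N) (e : 'I_N) : R :=
  match F with
  | IP tau => avg (pw_grad x u) e - tau e * jump u e
  | BR2 s r => avg (pw_grad x u) e + s e * avg (r e (jump u e)) e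
  end.

Definition ustarL (R : realType) (N : nat) (bc : bdry_cond R N)
    (u : pwpoly R N) (n : 'I_N) : R :=
  match bc with
  | Periodic => ustar u (ord_pred n)
  | Dirichlet _ _ => if n == 0%N :> nat then (u n).[-1] else ustar u (ord_pred n)
  end.

Definition ustarR (R : realType) (N : nat) (bc : bdry_cond R N)
    (u : pwpoly R N) (n : 'I_N) : R :=
  match bc with
  | Periodic => ustar u n
  | Dirichlet _ _ => if n.+1 == N then (u n).[1] else ustar u n
  end.

Definition qstarL (R : realType) (N : nat) (x : 'I_N.+1 -> R) (F : flux R N)
    (bc : bdry_cond R N) (t : R) (u : pwpoly R N) (n : 'I_N) : R :=
  match bc with
  | Periodic => qstar x F u (ord_pred n)
  | Dirichlet qbL _ =>
      if n == 0%N :> nat then qbL t u else qstar x F u (ord_pred n)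
  end.

Definition qstarR (R : realType) (N : nat) (x : 'I_N.+1 -> R) (F : flux R N)
    (bc : bdry_cond R N) (t : R) (u : pwpoly R N) (n : 'I_N) : R :=
  match bc with
  | Periodic => qstar x F u n
  | Dirichlet _ qbR => if n.+1 == N then qbR t u else qstar x F u n
  end.

Definition esfr_aux (R : realType) (N : nat) (x : 'I_N.+1 -> R) (p : nat)
    (kappa : R) (bc : bdry_cond R N) (u : pwpoly R N) : pwpoly R N :=
  fun n => (jac x n)^-1 *:
    ((u n)^`() + (ustarL bc u n - (u n).[-1]) *: (corrL p kappa)^`()
               + (ustarR bc u n - (u n).[1]) *: (corrR p kappa)^`()).

Definition esfr_primary (R : realType) (N : nat) (x : 'I_N.+1 -> R) (p : nat)
    (b c : R) (F : flux R N) (bc : bdry_cond R N) (t : R)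
    (u q : pwpoly R N) : pwpoly R N :=
  fun n => (b / jac x n) *:
    ((q n)^`() + (qstarL x F bc t u n - (q n).[-1]) *: (corrL p c)^`()
               + (qstarR x F bc t u n - (q n).[1]) *: (corrR p c)^`()).

(* du/dt as a function of u, after elimination of q. *)
Definition esfr_rhs (R : realType) (N : nat) (x : 'I_N.+1 -> R) (p : nat)
    (b kappa c : R) (F : flux R N) (bc : bdry_cond R N) (t : R)
    (u : pwpoly R N) : pwpoly R N :=
  esfr_primary x p b c F bc t u (esfr_aux x p kappa bc u).

Definition esfr_solution (R : realType) (N : nat) (x : 'I_N.+1 -> R) (p : nat)
    (b kappa c : R) (F : flux R N) (bc : bdry_cond R N) (I : set R)
    (u q : R -> pwpoly R N) : Prop :=
  forall t, I t ->
    [/\ pw_deg_le p (u t),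
        pw_deg_le p (q t),
        forall n, q t n = esfr_aux x p kappa bc (u t) n
      & forall n (r : R), -1 <= r <= 1 ->
          is_derive t 1 (fun s => (u s n).[r])
            (esfr_primary x p b c F bc t (u t) (q t) n).[r]].

(* Main.v *)
(* The IP and BR2 fluxes u*, q* do not involve q, so kappa enters the right-hand
   side only through L q_n, where L v = v' - v(-1) h_L' - v(1) h_R'.  A change of
   kappa changes g_L and g_R by multiples of Psi_(p+1) - Psi_(p-1), whose
   derivative is (2p + 1) Psi_p; hence it changes q_n by a multiple of Psi_p.
   Since Psi_p(-1) = (-1)^p, Psi_p(1) = 1 and (-1)^p h_L + h_R = Psi_p, the
   operator L vanishes at Psi_p. *)
Require Import Defs.
From HB Require Import structures.
From mathcomp Require Import all_boot all_order all_algebra.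
From mathcomp Require Import ring.
From mathcomp Require Import all_classical all_reals all_analysis.

Set Implicit Arguments.
Unset Strict Implicit.
Unset Printing Implicit Defensive.

Import Order.TTheory GRing.Theory Num.Theory.
Import numFieldNormedType.Exports.
Local Open Scope classical_set_scope.
Local Open Scope ring_scope.

(** At [a], only the Leibniz term in which all [m] derivatives fall on the power survives. The
    induction strips one factor at a time, absorbing the rest into the cofactor. *)
Lemma derivn_mul_XsubC_exp (R : comNzRingType) (m : nat) (a : R) (q : {poly R}) :
  ((('X - a%:P) ^+ m * q)^`(m)).[a] = (m`!)%:R * q.[a].
Proof.
elim: m q => [|m IHm] q; first by rewrite derivn0 expr0 mul1r fact0 mul1r.
have -> : (('X - a%:P) ^+ m.+1 * q)^`(m.+1) =
    (('X - a%:P) ^+ m * (m.+1%:R *: q + ('X - a%:P) * q^`()))^`(m).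
  rewrite derivSn; congr (_^`(m)).
  rewrite derivM deriv_exp derivB derivX derivC subr0 /= mul1r scaler_nat exprS.
  ring.
rewrite IHm hornerD hornerZ hornerM hornerXsubC subrr mul0r addr0 factS natrM.
ring.
Qed.

Section Legendre.

Variable R : realType.
Implicit Types (m : nat) (a : R).

Lemma legendre_coef_neq0 m : 2 ^+ m * (m`!)%:R != 0 :> R.
Proof. by rewrite mulf_neq0 ?expf_neq0 ?pnatr_eq0 // -lt0n fact_gt0. Qed.

(** Treats both endpoints at once: [a ^+ 2 = 1] splits ['X^2 - 1] as (X - a)(X + a), so Rodrigues'
    formula evaluates to m! (2a)^m / (2^m m!). *)
Lemma horner_legendre m a : a ^+ 2 = 1 -> (legendre R m).[a] = a ^+ m.
Proof.
move=> a2; rewrite /legendre hornerZ.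
have -> : 'X^2 - 1 = ('X - a%:P) * ('X + a%:P) :> {poly R}.
  by rewrite -[1 in LHS]polyC1 -a2 polyC_exp; ring.
rewrite exprMn derivn_mul_XsubC_exp horner_exp hornerD hornerX hornerC.
have -> : a + a = 2 * a by ring.
rewrite exprMn; have := legendre_coef_neq0 m.
by rewrite mulf_eq0 negb_or => /andP[? ?]; field; exact/andP.
Qed.

Lemma size_legendre m : (size (legendre R m) <= m.+1)%N.
Proof.
apply: leq_trans (size_scale_leq _ _) _.
apply/leq_sizeP => j mj.
rewrite coef_derivn nth_default ?mul0rn //.
apply: leq_trans (size_poly_exp_leq _ _) _.
rewrite -polyC1 size_XnsubC //=.
by rewrite mul2n -addnn ltn_add2l.
Qed.

(** In Rodrigues' formula, two derivatives of a power of X^2 - 1 combine the two preceding powers;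
    these produce the two lower Legendre polynomials. *)
Lemma deriv_legendre_sub m : (0 < m)%N ->
  (legendre R m.+1 - legendre R m.-1)^`() = (2 * m + 1)%:R *: legendre R m.
Proof.
case: m => // m _ /=; rewrite derivB /legendre !derivZ.
set w := 'X^2 - 1 : {poly R}.
have dw : w^`() = 'X *+ 2 by rewrite /w derivB derivXn -polyC1 derivC subr0.
have ddw : ((w ^+ m.+2)^`())^`() =
    (2 * m.+2 * (2 * m.+1 + 1))%:R *: w ^+ m.+1 + (4 * m.+1 * m.+2)%:R *: w ^+ m.
  rewrite deriv_exp dw /= derivMn derivM derivMn derivX deriv_exp dw /=.
  rewrite !scaler_nat exprS.
  (* Writing X^2 as w + 1 leaves only powers of [w]. *)
  transitivity ((w * w ^+ m *+ 2 + ('X^2 - 1 + 1) * w ^+ m *+ (4 * m.+1)) *+ m.+2).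
    ring.
  rewrite -/w; ring.
have -> : ((w ^+ m.+2)^`(m.+2))^`() = (((w ^+ m.+2)^`())^`())^`(m.+1).
  by rewrite -derivnS 2!derivSn.
rewrite ddw derivnD !derivnZ -derivnS scalerDr !scalerA.
have m1 : (m.+1)%:R != 0 :> R by rewrite pnatr_eq0.
have m2 : (m.+2)%:R != 0 :> R by rewrite pnatr_eq0.
have fm : (m`!)%:R != 0 :> R by rewrite pnatr_eq0 -lt0n fact_gt0.
have e2 : 2 ^+ m != 0 :> R by rewrite expf_neq0 // pnatr_eq0.
have two : 2 != 0 :> R by rewrite pnatr_eq0.
rewrite -addrA -scalerBl.
(* The [w ^+ m] term carries exactly the normalisation of [legendre R m], so it cancels the
   subtracted derivative. *)
have -> : (2 ^+ m.+2 * (m.+2)`!%:R)^-1 * (4 * m.+1 * m.+2)%:R = (2 ^+ m * (m`!)%:R)^-1 :> R.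
  rewrite !factS !natrM !exprS; field; exact/and4P.
rewrite subrr scale0r addr0; congr (_ *: _).
rewrite !factS !natrM !exprS; field; exact/and4P.
Qed.

End Legendre.

Section Correction.

Variables (R : realType) (p : nat).
Hypothesis p_gt0 : (0 < p)%N.
Implicit Types kappa c : R.

(** The left side is a weighted mean of Psi_(p-1) and Psi_(p+1); this form confines [kappa] to one
    scalar in front of their difference. *)
Let corr_interp kappa : admissible p kappa ->
  (1 + esfr_eta p kappa)^-1 *:
    (esfr_eta p kappa *: legendre R p.-1 + legendre R p.+1) =
  legendre R p.-1 +
    (1 + esfr_eta p kappa)^-1 *: (legendre R p.+1 - legendre R p.-1).
Proof.
move=> /lt0r_neq0 k0; apply: (scalerI k0).
move: (legendre R p.-1) (legendre R p.+1) => P Q.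
rewrite [in RHS]scalerDr !scalerA (divff k0) !scale1r -!mul_polyC; ring.
Qed.

Lemma deriv_corrL kappa : admissible p kappa ->
  (corrL p kappa)^`() = ((-1) ^+ p / 2) *: (legendre R p - legendre R p.-1)^`()
    - ((-1) ^+ p / 2 * (1 + esfr_eta p kappa)^-1 * (2 * p + 1)%:R) *: legendre R p.
Proof.
move=> k0; rewrite /corrL corr_interp // opprD addrA derivZ derivB derivZ.
by rewrite deriv_legendre_sub // scalerBr !scalerA.
Qed.

Lemma deriv_corrR kappa : admissible p kappa ->
  (corrR p kappa)^`() = 2^-1 *: (legendre R p + legendre R p.-1)^`()
    + (2^-1 * (1 + esfr_eta p kappa)^-1 * (2 * p + 1)%:R) *: legendre R p.
Proof.
move=> k0; rewrite /corrR corr_interp // addrA.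
set S := _ + legendre R p.-1; rewrite derivZ derivD derivZ.
by rewrite deriv_legendre_sub // scalerDr !scalerA.
Qed.

(** The parts depending on [c] enter with opposite signs and cancel, leaving two halves of Psi_p. *)
Lemma corrL_corrR c : (-1) ^+ p *: corrL p c + corrR p c = legendre R p.
Proof.
rewrite /corrL /corrR scalerA mulrA -expr2 sqrr_sign mul1r -scalerDr.
move: (legendre R p) => P; rewrite addrACA addNr addr0 -mulr2n -[P *+ 2]scaler_nat.
by rewrite scalerA mulVf ?scale1r // pnatr_eq0.
Qed.

Lemma size_legendre_comb kappa :
  (size ((1 + esfr_eta p kappa)^-1 *:
    (esfr_eta p kappa *: legendre R p.-1 + legendre R p.+1))
     <= p.+2)%N.
Proof.
apply: leq_trans (size_scale_leq _ _) _.
apply: leq_trans (size_polyD _ _) _; rewrite geq_max size_legendre andbT.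
apply: leq_trans (size_scale_leq _ _) _.
by apply: leq_trans (size_legendre _ _) _; rewrite prednK // ltnW.
Qed.

Lemma size_corrL kappa : (size (corrL p kappa) <= p.+2)%N.
Proof.
apply: leq_trans (size_scale_leq _ _) _.
apply: leq_trans (size_polyD _ _) _; rewrite size_polyN geq_max.
by rewrite size_legendre_comb (leq_trans (size_legendre _ _)).
Qed.

Lemma size_corrR kappa : (size (corrR p kappa) <= p.+2)%N.
Proof.
apply: leq_trans (size_scale_leq _ _) _.
apply: leq_trans (size_polyD _ _) _; rewrite geq_max.
by rewrite size_legendre_comb (leq_trans (size_legendre _ _)).
Qed.

Lemma correction_residual_legendre c :
  (legendre R p)^`() - (legendre R p).[-1] *: (corrL p c)^`()
    - (legendre R p).[1] *: (corrR p c)^`() = 0.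
Proof.
rewrite !horner_legendre ?sqrrN ?expr1n // scale1r -{1}(corrL_corrR c).
by rewrite derivD derivZ; ring.
Qed.

End Correction.

Lemma size_deriv_leq (R : nzRingType) (v : {poly R}) (m : nat) :
  (size v <= m.+1)%N -> (size v^`() <= m)%N.
Proof.
by move=> vm; rewrite (leq_trans (size_poly _ _)) // -subn1 leq_subLR add1n.
Qed.

Section Scheme.

Variables (R : realType) (N p : nat) (x : 'I_N.+1 -> R).
Variable bc : bdry_cond R N.
Hypothesis p_gt0 : (0 < p)%N.

(** The correction functions have degree at most p + 1, but only their derivatives enter. This makes
    the recomputed [q] admissible in [esfr_solution]. *)
Lemma esfr_aux_deg_le (kappa : R) (u : pwpoly R N) :
  pw_deg_le p u -> pw_deg_le p (esfr_aux x p kappa bc u).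
Proof.
move=> up n; apply: leq_trans (size_scale_leq _ _) _.
apply: leq_trans (size_polyD _ _) _; rewrite geq_max; apply/andP; split.
  apply: leq_trans (size_polyD _ _) _; rewrite geq_max; apply/andP; split.
    by apply: size_deriv_leq; apply: leq_trans (up n) _.
  apply: leq_trans (size_scale_leq _ _) _.
  by apply: size_deriv_leq; exact: size_corrL.
apply: leq_trans (size_scale_leq _ _) _.
by apply: size_deriv_leq; exact: size_corrR.
Qed.

Lemma esfr_aux_change (kappa1 kappa2 : R) (u : pwpoly R N) (n : 'I_N) :
  admissible p kappa1 -> admissible p kappa2 ->
  exists d : R, esfr_aux x p kappa1 bc u n =
    esfr_aux x p kappa2 bc u n + d *: legendre R p.
Proof.
move=> k1 k2; rewrite /esfr_aux !deriv_corrL // !deriv_corrR //.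
set e1 := (1 + esfr_eta p kappa1)^-1; set e2 := (1 + esfr_eta p kappa2)^-1.
set l := ustarL _ _ _ - _; set r := ustarR _ _ _ - _.
(* Collects the Psi_p terms of [deriv_corrL] and [deriv_corrR], weighted by the jumps [l] and [r];
   all else is free of [kappa]. *)
exists ((jac x n)^-1 * ((e1 - e2) * (2 * p + 1)%:R / 2 * (r - l * (-1) ^+ p))).
rewrite -!mul_polyC; ring.
Qed.

Lemma esfr_primary_add_legendre (b c : R) (F : flux R N) (t : R)
    (u q q' : pwpoly R N) (n : 'I_N) (d : R) :
  q n = q' n + d *: legendre R p ->
  esfr_primary x p b c F bc t u q n = esfr_primary x p b c F bc t u q' n.
Proof.
move=> qE; rewrite /esfr_primary qE; congr (_ *: _).
apply/eqP; rewrite -subr_eq0; apply/eqP.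
(* The flux values depend on [u] alone and cancel, so the difference is [d] times the residual of
   Psi_p. *)
rewrite -[RHS](scaler0 _ d) -(correction_residual_legendre p c).
move: (legendre R p) => P; rewrite derivD derivZ !hornerD !hornerZ.
rewrite -!mul_polyC; ring.
Qed.

Lemma esfr_rhs_kappa_indep (b c : R) (F : flux R N) (kappa1 kappa2 t : R)
    (u : pwpoly R N) (n : 'I_N) :
  admissible p kappa1 -> admissible p kappa2 ->
  esfr_rhs x p b kappa1 c F bc t u n = esfr_rhs x p b kappa2 c F bc t u n.
Proof.
move=> k1 k2; have [d qE] := esfr_aux_change u n k1 k2.
exact: esfr_primary_add_legendre qE.
Qed.

Lemma esfr_solution_change (b c : R) (F : flux R N) (kappa1 kappa2 : R)
    (I : set R) (u q : R -> pwpoly R N) :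
  admissible p kappa1 -> admissible p kappa2 ->
  esfr_solution x p b kappa1 c F bc I u q ->
  esfr_solution x p b kappa2 c F bc I u
    (fun t => esfr_aux x p kappa2 bc (u t)).
Proof.
move=> k1 k2 sol t It; have [up _ qE du] := sol t It.
split=> // [|n r r1]; first exact: esfr_aux_deg_le.
(* With the new [q] eliminated, the right-hand side can be switched back to [kappa1], where [qE]
   identifies the old [q]. *)
rewrite -[esfr_primary _ _ _ _ _ _ _ _ _ _]/(esfr_rhs _ _ _ _ _ _ _ _ _ _).
rewrite (esfr_rhs_kappa_indep _ _ _ _ _ _ k2 k1) /esfr_rhs.
by rewrite -(funext qE); exact: du.
Qed.

End Scheme.

Theorem corollary3p1 (R : realType) (N p : nat) (x : 'I_N.+1 -> R)
    (b c : R) (F : flux R N) (bc : bdry_cond R N)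
    (hN : (1 <= N)%N) (hp : (1 <= p)%N)
    (hx : forall i j : 'I_N.+1, (i < j)%N -> x i < x j)
    (hb : 0 < b) (hc : admissible p c)
    (hF : flux_ok x p bc F) :
  forall kappa1 kappa2 : R, admissible p kappa1 -> admissible p kappa2 ->
    (forall (t : R) (u : pwpoly R N), pw_deg_le p u ->
       forall n : 'I_N,
         esfr_rhs x p b kappa1 c F bc t u n =
         esfr_rhs x p b kappa2 c F bc t u n) /\
    (forall (I : set R) (u : R -> pwpoly R N), open I ->
       (exists q : R -> pwpoly R N, esfr_solution x p b kappa1 c F bc I u q) <->
       (exists q : R -> pwpoly R N, esfr_solution x p b kappa2 c F bc I u q)).
Proof.
move=> kappa1 kappa2 k1 k2; split=> [t u _ n|I u _].
  exact: esfr_rhs_kappa_indep.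
split=> -[q sol]; eexists; [exact: esfr_solution_change k1 k2 sol|].
exact: esfr_solution_change k2 k1 sol.
Qed.
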